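(* Let $n\ge1$, $\theta_n\in\Theta_n$, $X^n\sim P_{\theta_n}$, and choose the uniform prior on $\Theta_n$. Let $0\le\gamma<1$. Every credible set $D(X^n)$ of credible level $1-\gamma$ satisfies $$P_{\theta_n}\bigl(\theta_n\in D(X^n)\bigr)\ \ge\ 1-\frac{n}{2(1-\gamma)}\,\rho(p_n,q_n)^{n/2}\,e^{\,n\rho(p_n,q_n)^{n/2}},$$ i.e. $D(X^n)$ is a confidence set whose confidence level is the right-hand side.
   Context: Stochastic block model with two communities: for $n\ge1$ and $0\le m\le\lfloor n/2\rfloor$ let $\Theta_{n,m}=\{\theta_n\in\{0,1\}^n:\sum_i\theta_{n,i}=m\}$, except that for even $n$ and $m=n/2$, $\Theta_{n,n/2}=\{\theta_n\in\{0,1\}^n:\sum_i\theta_{n,i}=n/2,\ \theta_{n,1}=0\}$. Let $\Theta_n=\bigcup_{m=0}^{\lfloor n/2\rfloor}\Theta_{n,m}$; it has $2^{n-1}$ elements. Let $p_n,q_n\in[0,1]$. Under $P_{\theta_n}$ the observed random graph $X^n=\{X_{ij}:1\le i<j\le n\}\in\mathscr{X}_n=\{0,1\}^{\{(i,j):1\le i<j\le n\}}$ has independent edges with $P_{\theta_n}(X_{ij}=1)=Q_{ij}(\theta_n)$, where $Q_{ij}(\theta_n)=p_n$ if $\theta_{n,i}=\theta_{n,j}$ and $Q_{ij}(\theta_n)=q_n$ if $\theta_{n,i}\ne\theta_{n,j}$. Its probability mass function is $p_{\theta_n}(x^n)=\prod_{i<j}Q_{ij}(\theta_n)^{x_{ij}}(1-Q_{ij}(\theta_n))^{1-x_{ij}}$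 (with $0^0=1$). The uniform prior $\Pi_n$ gives mass $2^{-(n-1)}$ to each element of $\Theta_n$; the corresponding posterior is $\Pi(A\mid X^n)=\sum_{\theta\in A}p_{\theta}(X^n)\big/\sum_{\theta'\in\Theta_n}p_{\theta'}(X^n)$ for $A\subset\Theta_n$ (defined whenever the denominator is positive, which holds $P_{\theta_n}$-almost surely for each $\theta_n\in\Theta_n$). The prior predictive distribution is $P^{\Pi_n}(X^n\in A)=2^{-(n-1)}\sum_{\theta\in\Theta_n}P_\theta(X^n\in A)$. A credible set of credible level $1-\gamma$ ($0\le\gamma<1$) is a data-dependent subset $D(X^n)\subset\Theta_n$ (a map $x^n\mapsto D(x^n)$) with $\Pi(D(X^n)\mid X^n)\ge1-\gamma$, $P^{\Pi_n}$-almost surely; in case $\gamma=0$, $D(X^n)$ is the support of the posterior. A confidence set of level $1-\alpha$ is a ($\theta_n$-independent) set-valued map $x^n\mapsto C(x^n)\subset\Theta_n$ with $P_{\theta_n}(\theta_n\in C(X^n))\ge1-\alpha$. $\rho(p,q)=p^{1/2}q^{1/2}+(1-p)^{1/2}(1-q)^{1/2}$. *)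

(* Defs.v *)
From HB Require Import structures.
From mathcomp Require Import all_boot all_order all_algebra.
From mathcomp Require Import reals sequences exp.

Set Implicit Arguments.
Unset Strict Implicit.
Unset Printing Implicit Defensive.

Import Order.TTheory GRing.Theory Num.Theory.

Local Open Scope ring_scope.

Definition labeling (n : nat) : finType := {ffun 'I_n -> bool}.

Definition edge (n : nat) : finType := {e : 'I_n * 'I_n | (e.1 < e.2)%N}.

Definition graph (n : nat) : finType := {ffun edge n -> bool}.

(* [m.*2 == n] says that n is even and m = n/2; the first coordinate of
   theta then has to be 0 (indices start at 0 in ['I_n]). *)
Definition Theta_m (n m : nat) : {set labeling n} :=
  [set theta : labeling n |
    ((\sum_(i < n) theta i)%N == m) &&
    ((m.*2 == n) ==> [forall i : 'I_n, (val i == 0%N) ==> ~~ theta i])].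

Definition Theta (n : nat) : {set labeling n} :=
  \bigcup_(m < n./2.+1) Theta_m n m.

Section StochasticBlockModel.
Variables (R : realType) (n : nat) (p q : R).

Definition edge_prob (theta : labeling n) (e : edge n) : R :=
  if theta (val e).1 == theta (val e).2 then p else q.

Definition pmf (theta : labeling n) (x : graph n) : R :=
  \prod_(e : edge n)
    (edge_prob theta e ^+ x e * (1 - edge_prob theta e) ^+ (1 - x e)%N).

(* P_theta (X \in A), the law of the graph with mass function [pmf theta]. *)
Definition graph_prob (theta : labeling n) (A : {set graph n}) : R :=
  \sum_(x in A) pmf theta x.

(* Posterior for the uniform prior on [Theta n], meaningful for A inside
   [Theta n]; when the denominator vanishes, which is a null event for the prior
   predictive distribution, the value is 0 by the convention on division. *)
Definition posterior (A : {set labeling n}) (x : graph n) : R :=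
  (\sum_(theta in A) pmf theta x) / (\sum_(theta in Theta n) pmf theta x).

Definition posterior_support (x : graph n) : {set labeling n} :=
  [set theta in Theta n | 0 < posterior [set theta] x].

Definition prior_predictive (A : {set graph n}) : R :=
  (2 ^+ n.-1)^-1 * \sum_(theta in Theta n) graph_prob theta A.

Definition prior_predictive_as (E : {set graph n}) : Prop :=
  prior_predictive (~: E) = 0.

(* The credible level is 1 - gamma; for gamma = 0 the credible set is by
   convention the support of the posterior. *)
Definition credible_set (gamma : R) (D : graph n -> {set labeling n}) : Prop :=
  [/\ forall x, D x \subset Theta n,
      prior_predictive_as [set x | 1 - gamma <= posterior (D x) x] &
      gamma = 0 -> prior_predictive_as [set x | D x == posterior_support x]].

(* The confidence level is 1 - alpha. *)
Definition confidence_set (alpha : R) (C : graph n -> {set labeling n}) : Prop :=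
  (forall x, C x \subset Theta n) /\
  (forall theta, theta \in Theta n ->
    graph_prob theta [set x | theta \in C x] >= 1 - alpha).

End StochasticBlockModel.

(* [rho p q] is meant for p, q in [0, 1], where [Num.sqrt] is the power 1/2. *)
Definition rho (R : realType) (p q : R) : R :=
  Num.sqrt p * Num.sqrt q + Num.sqrt (1 - p) * Num.sqrt (1 - q).

(* Main.v *)
Require Import Defs.
From HB Require Import structures.
From mathcomp Require Import all_boot all_order all_algebra.
From mathcomp Require Import reals sequences exp.
From mathcomp Require Import ring lra zify.

(** If a credible set of level 1 - gamma misses the true labeling theta at a
    graph x of positive probability, then it lies inside the other labelings,
    whose posterior mass is therefore at least 1 - gamma. By Markov's
    inequality, the probability of a miss is at most 1 / (1 - gamma) times the
    P_theta-expectation of the posterior mass of the labelings other than theta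
    ([miscoverage_le]).

    That expectation is a sum over alternatives u. The normalization of the
    posterior is at least p_theta + p_u >= 2 sqrt (p_theta p_u), so the term of
    u is at most half of the Hellinger affinity between P_theta and P_u
    ([expected_posterior_le]). Edges being independent, the affinity is rho to
    the number of edges whose law differs under theta and u ([pmf_affinity]).
    These edges form the cut of the set of k vertices where theta and u
    disagree, and there are k (n - k) of them.

    A cut is also that of the complementary vertex set, so that k can be
    replaced by min (k, n - k) <= n / 2; then k (n - k) >= k n / 2 and the
    affinity is at most r ^ k for r = rho ^ (n / 2). As the parameter space
    holds no labeling together with its complement, distinct alternatives give
    distinct vertex sets after this replacement ([lighter_diff_inj]), none of
    them empty because theta itself gives the empty set. The affinities thus sum
    to at most the sum of r ^ |S| over nonempty vertex sets S, which is (1 + r) ^ n - 1 <= exp (n r) - 1 <= n r exp (n r)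
    ([affinity_sum_le], [exp_tail_le]). *)

Import Order.TTheory GRing.Theory Num.Theory.

Local Open Scope ring_scope.

(** * Labelings up to complement, and cuts *)

Section Labelings.
Set Implicit Arguments.
Unset Strict Implicit.
Variable n : nat.
Implicit Types (s t u : labeling n).

Definition weight s : nat := (\sum_(i < n) s i)%N.

Definition flip s : labeling n := [ffun i => ~~ s i].

Definition diff s t : labeling n := [ffun i => s i (+) t i].

Definition lighter s : labeling n :=
  if ((weight s).*2 <= n)%N then s else flip s.

Lemma diffxx s : diff s s = [ffun => false].
Proof. by apply/ffunP => i; rewrite !ffunE addbb. Qed.

Lemma weight0 : weight [ffun => false] = 0%N.
Proof. by rewrite /weight big1 // => i _; rewrite ffunE. Qed.

Lemma weight_flip s : (weight s + weight (flip s) = n)%N.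
Proof.
rewrite /weight -big_split /= -[RHS]card_ord -sum1_card.
by apply: eq_bigr => i _; rewrite ffunE; case: (s i).
Qed.

Lemma weight_card s : weight s = #|[set i | s i]|.
Proof.
rewrite -sum1_card big_mkcond /=.
by apply: eq_bigr => i _; rewrite inE; case: (s i).
Qed.

(** Weights in [Theta n] are at most n / 2 and those of a complementary pair add
    up to n, so both would be exactly n / 2; in that case the first label is required
    to be 0 on both. *)
Lemma flip_notin_Theta s : (0 < n)%N -> s \in Theta n -> flip s \notin Theta n.
Proof.
move=> n0 /bigcupP[m _]; rewrite inE -/(weight s) => /andP[/eqP sm /implyP sh].
apply/negP => /bigcupP[m' _].
rewrite inE -/(weight (flip s)) => /andP[/eqP sm' /implyP sh'].
have sn := weight_flip s.
have := ltn_ord m; have := ltn_ord m' => lm' lm.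
have /sh/forallP/(_ (Ordinal n0))/= s0 : m.*2 == n by apply/eqP; lia.
have /sh'/forallP/(_ (Ordinal n0))/= : m'.*2 == n by apply/eqP; lia.
by rewrite ffunE s0.
Qed.

(** The smaller side only determines [diff t u] up to complement, so it
    determines [u] up to complement; [Theta n] contains at most one of the two
    candidates. *)
Lemma lighter_diff_inj t : (0 < n)%N ->
  {in Theta n &, injective (fun u => lighter (diff t u))}.
Proof.
move=> n0 u v uT vT; rewrite /lighter.
have uv_flip (w w' : labeling n) : w \in Theta n -> w' \in Theta n ->
    (forall i, w i = ~~ w' i) -> w = w'.
  move=> wT w'T ww'; have := flip_notin_Theta n0 w'T.
  suff -> : flip w' = w by rewrite wT.
  by apply/ffunP => i; rewrite ffunE ww'.
by case: ifP => _; case: ifP => _ /ffunP E;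
  [apply/ffunP => i| apply: uv_flip => // i| apply: uv_flip => // i
  |apply/ffunP => i];
  have := E i; rewrite !ffunE; case: (t i); case: (u i); case: (v i).
Qed.

Definition cut s : {set edge n} := [set e | s (val e).1 != s (val e).2].

(** Orienting every cut edge from its label-1 end to its label-0 end reaches
    each pair of a label-1 and a label-0 vertex. *)
Lemma cut_ge s : (weight s * weight (flip s) <= #|cut s|)%N.
Proof.
pose orient (e : edge n) :=
  if s (val e).1 then val e else ((val e).2, (val e).1).
rewrite !weight_card -cardsX.
apply: leq_trans (leq_imset_card orient (cut s)).
apply: subset_leq_card; apply/subsetP => -[i j].
rewrite !inE /= ffunE => /andP[si /negPf sj].
have : i != j by apply: contraFneq sj => <-.
rewrite neq_ltn => /orP[ij|ji]; apply/imsetP.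
  exists (Sub (i, j) ij : edge n); first by rewrite inE SubK /= si sj.
  by rewrite /orient SubK /= si.
exists (Sub (j, i) ji : edge n); first by rewrite inE SubK /= si sj.
by rewrite /orient SubK /= sj.
Qed.

(** The heavier side has at least n / 2 vertices. This is stated without
    halves, since n may be odd. *)
Lemma lighter_cut_ge s : (n * weight (lighter s) <= #|cut s|.*2)%N.
Proof.
have := weight_flip s.
have cut_s : ((weight s * weight (flip s)).*2 <= #|cut s|.*2)%N.
  by rewrite leq_double cut_ge.
rewrite /lighter; case: (leqP (weight s).*2 n) => sn E; apply: leq_trans _ cut_s.
  by rewrite doubleMr mulnC leq_mul2l; lia.
by rewrite doubleMl leq_mul2r; lia.
Qed.

(** The binomial theorem, as the expansion of a product of n factors 1 + r. *)
Lemma sum_weight (R : comNzRingType) (r : R) :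
  \sum_(s : labeling n) r ^+ weight s = (1 + r) ^+ n.
Proof.
transitivity (\sum_(s : labeling n) \prod_(i < n) r ^+ s i).
  by apply: eq_bigr => s _; rewrite expr_sum.
rewrite -(bigA_distr_bigA (fun _ b => r ^+ (nat_of_bool b))) /=.
by rewrite prodr_const card_ord big_bool /= expr1 expr0 addrC.
Qed.

End Labelings.

(** * Affinities of the edge laws and coverage of credible sets *)

Section Affinity.
Set Implicit Arguments.
Unset Strict Implicit.
Variable R : realType.
Implicit Types p q a b : R.

Lemma sqrtM_le_mean a b : 0 <= a -> 0 <= b ->
  2 * (Num.sqrt a * Num.sqrt b) <= a + b.
Proof.
move=> a0 b0; have := sqr_sqrtr a0; have := sqr_sqrtr b0.
have := sqr_ge0 (Num.sqrt a - Num.sqrt b); nra.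
Qed.

Lemma rho_ge0 p q : 0 <= rho p q.
Proof. by rewrite addr_ge0 // mulr_ge0 ?sqrtr_ge0. Qed.

Lemma rho_le1 p q : 0 <= p <= 1 -> 0 <= q <= 1 -> rho p q <= 1.
Proof.
move=> /andP[p0 p1] /andP[q0 q1]; rewrite /rho.
have := sqrtM_le_mean p0 q0.
have := @sqrtM_le_mean (1 - p) (1 - q); rewrite !subr_ge0 => /(_ p1 q1).
lra.
Qed.

Lemma rhoxx p : 0 <= p <= 1 -> rho p p = 1.
Proof.
by move=> /andP[p0 p1]; rewrite /rho -!expr2 !sqr_sqrtr ?subr_ge0 // subrKC.
Qed.

Lemma rhoC p q : rho p q = rho q p.
Proof. by rewrite /rho mulrC [X in _ + X]mulrC. Qed.

Variables (n : nat) (p q : R).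
Hypotheses (hp : 0 <= p <= 1) (hq : 0 <= q <= 1).
Implicit Types (t u : labeling n) (x : graph n).

Lemma edge_prob01 t e : 0 <= edge_prob p q t e <= 1.
Proof. by rewrite /edge_prob; case: ifP. Qed.

Lemma bernoulli_ge0 a (b : bool) : 0 <= a <= 1 ->
  0 <= a ^+ b * (1 - a) ^+ (1 - b)%N.
Proof. by move=> /andP[a0 a1]; rewrite mulr_ge0 // exprn_ge0 // subr_ge0. Qed.

Lemma pmf_ge0 t x : 0 <= pmf p q t x.
Proof. by apply: prodr_ge0 => e _; exact/bernoulli_ge0/edge_prob01. Qed.

Lemma sqrt_prod (I : finType) (F : I -> R) : (forall i, 0 <= F i) ->
  Num.sqrt (\prod_i F i) = \prod_i Num.sqrt (F i).
Proof.
move=> F0.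
suff [_ ->] : 0 <= \prod_i F i /\
  Num.sqrt (\prod_i F i) = \prod_i Num.sqrt (F i) by [].
apply: (big_rec2 (fun a b => 0 <= a /\ Num.sqrt a = b)).
  by rewrite sqrtr1.
by move=> i b a _ [a0 <-]; rewrite mulr_ge0 // sqrtrM.
Qed.

(** Affinities are multiplicative over independent edges, and an edge
    contributes [rho p q] or 1 according to whether its law differs under [t] and [u]. *)
Lemma pmf_affinity t u :
  \sum_x Num.sqrt (pmf p q t x) * Num.sqrt (pmf p q u x) =
  rho p q ^+ #|cut (diff t u)|.
Proof.
pose bern a (b : bool) := a ^+ b * (1 - a) ^+ (1 - b)%N.
pose F (e : edge n) (b : bool) :=
  Num.sqrt (bern (edge_prob p q t e) b) * Num.sqrt (bern (edge_prob p q u e) b).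
transitivity (\sum_(x : graph n) \prod_e F e (x e)).
  apply: eq_bigr => x _; rewrite /pmf !sqrt_prod -?big_split //= => e;
  exact/bernoulli_ge0/edge_prob01.
rewrite -(bigA_distr_bigA F) /=.
have FE e : \sum_b F e b = if e \in cut (diff t u) then rho p q else 1.
  rewrite big_bool /F /bern /= !expr0 !expr1 !mulr1 !mul1r -/(rho _ _).
  rewrite inE !ffunE /edge_prob.
  by case: (t _); case: (t _); case: (u _); case: (u _) => //=;
    rewrite ?rhoxx // rhoC.
by rewrite (eq_bigr _ (fun e _ => FE e)) -big_mkcond prodr_const.
Qed.

(** The total mass is the affinity of the law with itself. *)
Lemma pmf_sum1 t : \sum_x pmf p q t x = 1.
Proof.
transitivity (rho p q ^+ #|cut (diff t t)|).
  rewrite -pmf_affinity; apply: eq_bigr => x _.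
  by rewrite -expr2 sqr_sqrtr ?pmf_ge0.
suff -> : cut (diff t t) = set0 by rewrite cards0.
by apply/setP => e; rewrite diffxx !inE !ffunE.
Qed.

(** With a and b the masses of x under [t] and [u], the integrand is at most
    a b / (a + b), which is at most sqrt (a b) / 2 since
    a + b >= 2 sqrt (a b). *)
Lemma expected_posterior_le t u : t \in Theta n -> u \in Theta n -> u != t ->
  \sum_x pmf p q t x * posterior p q [set u] x <=
  rho p q ^+ #|cut (diff t u)| / 2.
Proof.
move=> tT uT ut; rewrite -pmf_affinity mulr_suml; apply: ler_sum => x _.
rewrite /posterior big_set1.
set a := pmf p q t x; set b := pmf p q u x; set Z := \sum_(_ in _) _.
have a0 : 0 <= a by exact: pmf_ge0.
have b0 : 0 <= b by exact: pmf_ge0.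
have abZ : a + b <= Z.
  rewrite /Z (bigD1 t) //= lerD2l (bigD1 u) /= ?uT // lerDl.
  by apply: sumr_ge0 => v _; exact: pmf_ge0.
have s0 : 0 <= Num.sqrt a * Num.sqrt b by rewrite mulr_ge0 ?sqrtr_ge0.
have [Z0|Z0] := leP Z 0.
  (* The normalization vanishes only if both masses do. *)
  have -> : a = 0 by lra.
  by rewrite mul0r sqrtr0 !mul0r.
rewrite mulrA ler_pdivrMr //.
have M : 2 * (Num.sqrt a * Num.sqrt b) <= Z.
  exact: le_trans (sqrtM_le_mean a0 b0) abZ.
have E : a * b = (Num.sqrt a * Num.sqrt b) ^+ 2 by rewrite exprMn !sqr_sqrtr.
rewrite E; nra.
Qed.

(** Here sqrt rho ^ n plays the role of rho ^ (n / 2), and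
    rho ^ #cut = sqrt rho ^ (2 #cut) can be compared with it because
    0 <= sqrt rho <= 1. The subtracted 1 is the term of the zero labeling,
    the image of [t] itself. *)
Lemma affinity_sum_le t : (0 < n)%N -> t \in Theta n ->
  \sum_(u in Theta n | u != t) rho p q ^+ #|cut (diff t u)| <=
  (1 + Num.sqrt (rho p q) ^+ n) ^+ n - 1.
Proof.
move=> n0 tT; set r := Num.sqrt (rho p q) ^+ n.
have s0 : 0 <= Num.sqrt (rho p q) by exact: sqrtr_ge0.
have s1 : Num.sqrt (rho p q) <= 1.
  by rewrite -sqrtr1 ler_sqrt // rho_le1.
pose f u := lighter (diff t u).
have ft : f t = [ffun => false].
  by rewrite /f diffxx /lighter weight0.
have finj : {in Theta n &, injective f} by exact: lighter_diff_inj.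
apply: (@le_trans _ _ (\sum_(u in Theta n | u != t) r ^+ weight (f u))).
  apply: ler_sum => u _.
  rewrite -[rho p q in leLHS](sqr_sqrtr (rho_ge0 p q)) -!exprM.
  apply: ler_wiXn2l => //.
  by rewrite mul2n lighter_cut_ge.
rewrite -sum_weight [X in _ <= X - 1](bigD1 [ffun => false]) //=.
rewrite weight0 expr0 [X in _ <= X - 1]addrC addrK.
have -> : \sum_(u in Theta n | u != t) r ^+ weight (f u) =
    \sum_(s in f @: (Theta n :\ t)) r ^+ weight s.
  rewrite big_imset /=; last first.
    by move=> u v /setD1P[_ uT] /setD1P[_ vT]; exact: finj.
  by apply: eq_bigl => u; rewrite !inE andbC.
rewrite [leRHS]big_mkcond [leLHS]big_mkcond; apply: ler_sum => s _.
have r0 : 0 <= r ^+ weight s by rewrite !exprn_ge0.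
case: ifP => [/imsetP[u /setD1P[ut uT] ->]|_]; last by case: ifP.
by rewrite -ft (inj_in_eq finj) // ut.
Qed.

(** Both sides are compared with exp y - 1, where y = n r; the upper bound
    exp y - 1 <= y exp y is 1 - y <= exp (- y) multiplied by exp y. *)
Lemma exp_tail_le (r : R) : 0 <= r ->
  (1 + r) ^+ n - 1 <= n%:R * r * expR (n%:R * r).
Proof.
move=> r0; apply: (@le_trans _ _ (expR (n%:R * r) - 1)).
  rewrite lerD2r expRM_natl.
  by rewrite lerXn2r ?nnegrE ?expR_ge0 ?addr_ge0 ?expR_ge1Dx.
set y := n%:R * r.
have := expR_ge1Dx (- y); have := expRxMexpNx_1 y; have := expR_gt0 y.
nra.
Qed.

(** Markov's inequality, pointwise in the graph: if [D x] misses [t], it is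
    contained in the set of alternatives, whose posterior mass then is at least
    the credible level. *)
Lemma miscoverage_le gamma (D : graph n -> {set labeling n}) t :
  0 <= gamma < 1 -> credible_set p q gamma D -> t \in Theta n ->
  (1 - gamma) * graph_prob p q t (~: [set x | t \in D x]) <=
  \sum_(u in Theta n | u != t) \sum_x pmf p q t x * posterior p q [set u] x.
Proof.
move=> /andP[g0 g1] [DT Das _] tT.
have post_ge0 u x : 0 <= posterior p q [set u] x.
  by rewrite divr_ge0 ?sumr_ge0 // => v _; exact: pmf_ge0.
rewrite exchange_big /= /graph_prob mulr_sumr big_mkcond /=.
apply: ler_sum => x _; rewrite -mulr_sumr inE inE.
case: ifPn => [tD|_]; last first.
  by rewrite mulr_ge0 ?pmf_ge0 ?sumr_ge0.
rewrite mulrC.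
have [t0|t0] := eqVneq (pmf p q t x) 0; first by rewrite t0 !mul0r.
apply: ler_wpM2l; first exact: pmf_ge0.
(* The prior charges [t], so an x with positive mass under [t] is not in any
   null set of the prior predictive distribution. *)
have Dx : 1 - gamma <= posterior p q (D x) x.
  apply: contraT => nDx; move/eqP: Das; rewrite mulf_eq0 invr_eq0 expf_eq0.
  rewrite (pnatr_eq0 R 2) /= andbF /= psumr_eq0; last first.
    by move=> u _; apply: sumr_ge0 => y _; exact: pmf_ge0.
  move=> /allP/(_ t (mem_index_enum t)); rewrite tT /= psumr_eq0; last first.
    by move=> y _; exact: pmf_ge0.
  move=> /allP/(_ x (mem_index_enum x)).
  by rewrite !inE nDx (negPf t0).
apply: le_trans Dx _; rewrite /posterior mulr_suml.
rewrite big_mkcond [leRHS]big_mkcond; apply: ler_sum => u _ /=.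
rewrite big_set1; case: ifP => uD; last first.
  by case: ifP => // _; have := post_ge0 u x; rewrite /posterior big_set1.
rewrite (subsetP (DT x)) //=; case: eqP => // ut.
by rewrite -ut uD in tD.
Qed.

Lemma coverage_ge gamma (D : graph n -> {set labeling n}) t : (0 < n)%N ->
  0 <= gamma < 1 -> credible_set p q gamma D -> t \in Theta n ->
  1 - n%:R / (2 * (1 - gamma)) * rho p q `^ (n%:R / 2)
      * expR (n%:R * rho p q `^ (n%:R / 2)) <=
  graph_prob p q t [set x | t \in D x].
Proof.
move=> n0 hg hD tT; have [g0 g1] := andP hg.
have -> : rho p q `^ (n%:R / 2) = Num.sqrt (rho p q) ^+ n.
  rewrite -powR12_sqrt ?rho_ge0 // -powR_mulrn ?powR_ge0 // -powRrM.
  by rewrite mulrC.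
set r := Num.sqrt (rho p q) ^+ n.
have r0 : 0 <= r by rewrite exprn_ge0 ?sqrtr_ge0.
have total : graph_prob p q t [set x | t \in D x] +
    graph_prob p q t (~: [set x | t \in D x]) = 1.
  rewrite -(pmf_sum1 t) (bigID (mem [set x | t \in D x])) /=.
  by congr (_ + _); apply: eq_bigl => x; rewrite inE.
have H := miscoverage_le hg hD tT.
have : (1 - gamma) * graph_prob p q t (~: [set x | t \in D x]) <=
    n%:R * r * expR (n%:R * r) / 2.
  apply: le_trans H _.
  apply: (@le_trans _ _ (((1 + r) ^+ n - 1) / 2)); last first.
    by rewrite ler_pM2r ?invr_gt0 // exp_tail_le.
  apply: (@le_trans _ _
    ((\sum_(u in Theta n | u != t) rho p q ^+ #|cut (diff t u)|) / 2)).
    rewrite mulr_suml; apply: ler_sum => u /andP[uT ut].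
    exact: expected_posterior_le.
  by rewrite ler_pM2r ?invr_gt0 // affinity_sum_le.
have g1' : 0 < 1 - gamma by rewrite subr_gt0.
rewrite mulrC -ler_pdivlMr //.
have -> : n%:R * r * expR (n%:R * r) / 2 / (1 - gamma) =
  n%:R / (2 * (1 - gamma)) * r * expR (n%:R * r).
  by field; rewrite lt0r_neq0.
lra.
Qed.

End Affinity.

Theorem proposition5p4 (R : realType) (n : nat) (hn : (1 <= n)%N)
    (p q : R) (hp : 0 <= p <= 1) (hq : 0 <= q <= 1)
    (theta : labeling n) (htheta : theta \in Theta n)
    (gamma : R) (hgamma : 0 <= gamma < 1)
    (D : graph n -> {set labeling n}) (hD : credible_set p q gamma D) :
  let alpha : R :=
    n%:R / (2 * (1 - gamma)) * rho p q `^ (n%:R / 2)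
      * expR (n%:R * rho p q `^ (n%:R / 2)) in
  graph_prob p q theta [set x | theta \in D x] >= 1 - alpha
  /\ confidence_set p q alpha D.
Proof.
split; first exact: coverage_ge.
split; first by case: hD.
by move=> t tT; exact: coverage_ge.
Qed.
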